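(* Let $(M,\phi,\xi,\eta,g)$ be a $(2n+1)$-dimensional $N(\kappa)$-contact metric manifold with its generalized Tanaka-Webster connection $\mathring{\nabla}$, and let $\mathring{\mathcal{Z}}$ be the concircular curvature tensor of $\mathring{\nabla}$. If $M$ is $\phi$-concircularly flat with respect to $\mathring\nabla$, i.e. $g(\mathring{\mathcal{Z}}(\phi X_1,\phi X_2)\phi X_3,\phi X_4)=0$ for all vector fields $X_1,X_2,X_3,X_4$ on $M$, then $M$ is $\eta$-Einstein, i.e. there are smooth functions $A,B$ on $M$ such that $S(X_1,X_2)=A\,g(X_1,X_2)+B\,\eta(X_1)\eta(X_2)$ for all vector fields $X_1,X_2$, where $S$ is the Ricci tensor of the Levi-Civita connection of $g$.
   Context: A contact metric manifold $(M,\phi,\xi,\eta,g)$ is a smooth manifold of dimension $2n+1$ ($n\ge 1$) with a $(1,1)$-tensor field $\phi$, a vector field $\xi$, a $1$-form $\eta$ and a Riemannian metric $g$ such that $\phi^2X=-X+\eta(X)\xi$, $\phi\xi=0$, $\eta\circ\phi=0$, $\eta(\xi)=1$, $g(\phi X,\phi Y)=g(X,Y)-\eta(X)\eta(Y)$ and $d\eta(X,Y)=g(X,\phi Y)$, where $d\eta(X,Y)=\frac12(X\eta(Y)-Y\eta(X)-\eta([X,Y]))$. Put $h=\frac12\mathcal{L}_\xi\phi$. Let $\nabla$ be the Levi-Civita connection, with curvature $R(X,Y)Z=\nabla_X\nabla_YZ-\nabla_Y\nabla_XZ-\nabla_{[X,Y]}Z$. For a real constant $\kappa$, $M$ is an $N(\kappa)$-contact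 metric manifold if $R(X,Y)\xi=\kappa[\eta(Y)X-\eta(X)Y]$ for all vector fields $X,Y$. The generalized Tanaka-Webster connection is $\mathring{\nabla}_XY=\nabla_XY+((\nabla_X\eta)Y)\xi-\eta(Y)\nabla_X\xi+\eta(X)\phi Y$; on an $N(\kappa)$-contact metric manifold it equals $\nabla_XY+g(X+hX,\phi Y)\xi+\eta(X)\phi Y+\eta(Y)\phi(X+hX)$. Its curvature is $\mathring{R}(X,Y)Z=\mathring{\nabla}_X\mathring{\nabla}_YZ-\mathring{\nabla}_Y\mathring{\nabla}_XZ-\mathring{\nabla}_{[X,Y]}Z$, its Ricci curvature is $\mathring{S}(X,Y)=\sum_{i=1}^{2n+1}g(\mathring{R}(X,E_i)E_i,Y)$ for a local orthonormal frame $\{E_i\}$, and its scalar curvature is $\mathring{\tau}=\sum_i\mathring{S}(E_i,E_i)$. The concircular curvature tensor of $\mathring\nabla$ is $$\mathring{\mathcal{Z}}(X_1,X_2)X_3=\mathring{R}(X_1,X_2)X_3-\frac{\mathring{\tau}}{2n(2n+1)}[g(X_2,X_3)X_1-g(X_1,X_3)X_2].$$ *)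

(* Defs.v *)
From HB Require Import structures.
From mathcomp Require Import all_boot all_order all_algebra.
From mathcomp Require Import all_classical all_reals all_analysis.

Set Implicit Arguments.
Unset Strict Implicit.
Unset Printing Implicit Defensive.

Import Order.TTheory GRing.Theory Num.Theory.
Import numFieldNormedType.Exports.

Local Open Scope classical_set_scope.
Local Open Scope ring_scope.

(* The partial derivatives of f of order at most k exist and are continuous   *)
(* at every point of U. Only meaningful for open U.                           *)
Fixpoint Ck_on (R : realType) (m k : nat) (U : set 'rV[R]_m)
    (f : 'rV[R]_m -> R) : Prop :=
  (forall x, U x -> {for x, continuous f}) /\
  (if k is k'.+1 then
     forall i : 'I_m, let e : 'rV[R]_m := delta_mx 0 i in
       (forall x, U x -> derivable f x e) /\ Ck_on k' U (fun x => 'D_e f x)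
   else True).

Definition smooth_on (R : realType) (m : nat) (U : set 'rV[R]_m)
    (f : 'rV[R]_m -> R) : Prop := forall k, Ck_on k U f.

Section SmoothOn.
Context (R : realType) (m : nat) (U : set 'rV[R]_m).
Implicit Types (f g : 'rV[R]_m -> R).

Lemma Ck_on_cont k f : Ck_on k U f -> forall x, U x -> {for x, continuous f}.
Proof. by case: k => [|k] []. Qed.

Lemma Ck_on_pred k f : Ck_on k.+1 U f -> Ck_on k U f.
Proof.
elim: k f => [|k IH] f; first by case.
by move=> [cf df]; split=> // i; have [? /IH] := df i.
Qed.

Lemma Ck_on_ext k f g : open U -> (forall x, U x -> f x = g x) ->
  Ck_on k U f -> Ck_on k U g.
Proof.
move=> oU; elim: k f g => [|k IH] f g fg [cf df].
all: have nfg x : U x -> \near x, f x = g x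
  by move=> Ux; apply: filterS (open_nbhs_nbhs (conj oU Ux)).
all: have cg x : U x -> {for x, continuous g} by
  move=> Ux; rewrite /prop_for /continuous_at -(fg x Ux);
  apply: cvg_trans (cf x Ux); exact: (near_eq_cvg (nfg x Ux)).
  by split.
split=> // i; have [dfi cki] := df i; split=> [x Ux|].
  exact: near_eq_derivable (nfg x Ux) (dfi x Ux).
by apply: IH cki => x Ux; exact: near_eq_derive (nfg x Ux).
Qed.

Lemma Ck_on_cst k (a : R) : Ck_on k U (cst a).
Proof.
elim: k a => [|k IH] a; first by split=> // x _; exact: cst_continuous.
split=> [x _|i]; first exact: cst_continuous.
split=> [x _|]; first exact: derivable_cst.
rewrite [X in Ck_on _ _ X](_ : _ = cst 0); first exact: IH.
by apply/funext => x; exact: derive_cst.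
Qed.

Lemma Ck_on_add k f g : open U -> Ck_on k U f -> Ck_on k U g ->
  Ck_on k U (f \+ g).
Proof.
move=> oU; elim: k f g => [|k IH] f g Hf Hg.
  split=> // x Ux; apply: continuousD.
    exact: (Ck_on_cont Hf).
  exact: (Ck_on_cont Hg).
split=> [x Ux|i].
  by apply: continuousD; [exact: (Ck_on_cont Hf)|exact: (Ck_on_cont Hg)].
have [df cf] := Hf.2 i; have [dg cg] := Hg.2 i; split=> [x Ux|].
  exact: derivableD (df x Ux) (dg x Ux).
apply: Ck_on_ext oU _ (IH _ _ cf cg) => x Ux /=.
by rewrite (deriveD (df x Ux) (dg x Ux)).
Qed.

Lemma Ck_on_mul k f g : open U -> Ck_on k U f -> Ck_on k U g ->
  Ck_on k U (f \* g).
Proof.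
move=> oU; elim: k f g => [|k IH] f g Hf Hg.
  split=> // x Ux; apply: continuousM.
    exact: (Ck_on_cont Hf).
  exact: (Ck_on_cont Hg).
split=> [x Ux|i].
  by apply: continuousM; [exact: (Ck_on_cont Hf)|exact: (Ck_on_cont Hg)].
have [df cf] := Hf.2 i; have [dg cg] := Hg.2 i; split=> [x Ux|].
  exact: derivableM (df x Ux) (dg x Ux).
apply: Ck_on_ext oU _
  (Ck_on_add oU (IH _ _ (Ck_on_pred Hf) cg) (IH _ _ (Ck_on_pred Hg) cf)).
by move=> x Ux /=; rewrite (deriveM (df x Ux) (dg x Ux)).
Qed.

End SmoothOn.

Record chart (R : realType) (m : nat) (T : topologicalType) := Chart {
  dom : set T;
  cod : set 'rV[R]_m;
  coord : T -> 'rV[R]_m;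
  param : 'rV[R]_m -> T;
  dom_open : open dom;
  cod_open : open cod;
  coord_cod : forall p, dom p -> cod (coord p);
  param_dom : forall x, cod x -> dom (param x);
  coordK : forall p, dom p -> param (coord p) = p;
  paramK : forall x, cod x -> coord (param x) = x;
  coord_cont : forall p, dom p -> {for p, continuous coord};
  param_cont : forall x, cod x -> {for x, continuous param} }.

Arguments dom_open {R m T} c.
Arguments cod_open {R m T} c.

Definition compatible (R : realType) (m : nat) (T : topologicalType)
    (c c' : chart R m T) : Prop :=
  forall j : 'I_m, smooth_on [set x | cod c x /\ dom c' (param c x)]
    (fun x => coord c' (param c x) 0 j).

Record manifold (R : realType) (m : nat) := Manifold {
  space :> topologicalType;
  space_hausdorff : hausdorff_space space;
  space_second_countable : @second_countable space;
  atlas : set (chart R m space);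
  atlas_cover : forall p, exists2 c, atlas c & dom c p;
  atlas_compat : forall c c', atlas c -> atlas c' -> compatible c c' }.

Section SmoothFunctions.
Context (R : realType) (m : nat) (M : manifold R m).

Definition smooth_fun : {pred M -> R} := fun f : M -> R =>
  `[< forall c, atlas c -> smooth_on (cod c) (f \o param c) >].

Record Cinf := MkCinf { Cinf_fun :> M -> R; _ : Cinf_fun \in smooth_fun }.

HB.instance Definition _ := [isSub for Cinf_fun].
HB.instance Definition _ := [Choice of Cinf by <:].

Lemma smooth_subring_closed : subring_closed smooth_fun.
Proof.
have E f : f \in smooth_fun <->
    forall c, atlas c -> smooth_on (cod c) (f \o param c).
  by rewrite unfold_in; split=> /asboolP.
have C a : cst a \in smooth_fun by apply/E => c _ k; exact: Ck_on_cst.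
have MM f g : f \in smooth_fun -> g \in smooth_fun -> f * g \in smooth_fun.
  move=> /E Hf /E Hg; apply/E => c ac k.
  by have := Ck_on_mul (cod_open c) (Hf c ac k) (Hg c ac k).
split=> [|f g Hf Hg|//]; first exact: C.
have Hg' := MM _ _ (C (-1)) Hg.
have -> : f - g = f + cst (-1) * g by rewrite mulN1r.
move: Hf Hg' => /E Hf /E Hg'; apply/E => c ac k.
by have := Ck_on_add (cod_open c) (Hf c ac k) (Hg' c ac k).
Qed.

HB.instance Definition _ :=
  GRing.isSubringClosed.Build (M -> R) smooth_fun smooth_subring_closed.

Lemma smooth_scaler_closed : scaler_closed smooth_fun.
Proof.
move=> a f Hf; have -> : a *: f = cst a * f by [].
apply: rpredM => //; rewrite unfold_in; apply/asboolP => c _ k.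
exact: Ck_on_cst.
Qed.

HB.instance Definition _ :=
  GRing.isScaleClosed.Build R (M -> R) smooth_fun smooth_scaler_closed.

HB.instance Definition _ := [SubChoice_isSubZmodule of Cinf by <:].
HB.instance Definition _ :=
  GRing.SubZmodule_isSubPzRing.Build _ _ Cinf (subringClosedP _).
HB.instance Definition _ :=
  GRing.SubPzRing_isSubComPzRing.Build _ _ Cinf.
HB.instance Definition _ := [SubZmodule_isSubLmodule of Cinf by <:].

End SmoothFunctions.

(* Vector fields are the R-linear derivations of the algebra of smooth        *)
(* functions.                                                                 *)
Section VectorFields.
Context (R : realType) (m : nat) (M : manifold R m).
Local Notation C := (Cinf M).

Definition derivation : {pred C -> C} := fun X : C -> C =>
  `[< [/\ forall f h, X (f + h) = X f + X h,
          forall (a : R) f, X (a *: f) = a *: X f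
        & forall f h, X (f * h) = X f * h + f * X h] >].

Record vfield := MkVfield { vfield_fun :> C -> C; _ : vfield_fun \in derivation }.

HB.instance Definition _ := [isSub for vfield_fun].
HB.instance Definition _ := [Choice of vfield by <:].

Lemma derivationP (X : C -> C) : reflect
  [/\ forall f h, X (f + h) = X f + X h,
      forall (a : R) f, X (a *: f) = a *: X f
    & forall f h, X (f * h) = X f * h + f * X h] (X \in derivation).
Proof. by rewrite unfold_in; exact: asboolP. Qed.

Lemma vfieldP (X : vfield) : vfield_fun X \in derivation. Proof. exact: valP. Qed.

Lemma derivation_zmod_closed : zmod_closed derivation.
Proof.
split=> [|X Y /derivationP[XD XZ XM] /derivationP[YD YZ YM]].
  apply/derivationP; split=> [f h|a f|f h] /=.
  - by rewrite addr0.
  - by rewrite scaler0.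
  - by rewrite mul0r mulr0 addr0.
apply/derivationP; split=> [f h|a f|f h] /=; rewrite !fctE /=.
- by rewrite XD YD opprD addrACA.
- by rewrite XZ YZ scalerBr.
- by rewrite XM YM opprD addrACA mulrBl mulrBr.
Qed.

HB.instance Definition _ :=
  GRing.isZmodClosed.Build (C -> C) derivation derivation_zmod_closed.
HB.instance Definition _ := [SubChoice_isSubZmodule of vfield by <:].

Lemma scale_derivation (u : C) (X : vfield) :
  (fun f => u * X f) \in derivation.
Proof.
have /derivationP[XD XZ XM] := vfieldP X.
apply/derivationP; split=> [f h|a f|f h].
- by rewrite XD mulrDr.
- by rewrite XZ; apply: val_inj; apply/funext => p; exact: mulrCA.
- by rewrite XM mulrDr mulrA mulrCA.
Qed.

Definition vscale (u : C) (X : vfield) := MkVfield (scale_derivation u X).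

Lemma vfield_ext (X Y : vfield) : (forall f, X f = Y f) -> X = Y.
Proof. by move=> XY; apply: val_inj; apply/funext. Qed.

Fact vscaleA u v X : vscale u (vscale v X) = vscale (u * v) X.
Proof. by apply: vfield_ext => f /=; rewrite mulrA. Qed.
Fact vscale1 : left_id 1 vscale.
Proof. by move=> X; apply: vfield_ext => f /=; rewrite mul1r. Qed.
Fact vscaleDr : right_distributive vscale +%R.
Proof. by move=> u X Y; apply: vfield_ext => f; exact: mulrDr. Qed.
Fact vscaleDl X : {morph vscale^~ X : u v / u + v}.
Proof. by move=> u v; apply: vfield_ext => f; exact: mulrDl. Qed.

HB.instance Definition _ := GRing.Zmodule_isLmodule.Build C vfield
  vscaleA vscale1 vscaleDr vscaleDl.

Lemma bracket_derivation (X Y : vfield) :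
  (fun f => X (Y f) - Y (X f)) \in derivation.
Proof.
have /derivationP[XD XZ XM] := vfieldP X.
have /derivationP[YD YZ YM] := vfieldP Y.
apply/derivationP; split=> [f h|a f|f h].
- by rewrite YD XD XD YD opprD addrACA.
- by rewrite YZ XZ XZ YZ scalerBr.
- rewrite YM XD !XM YD !YM mulrBl mulrBr.
  set a := X (Y f) * h; set b := Y f * X h; set c := X f * Y h.
  set d := f * X (Y h); set a' := Y (X f) * h; set d' := f * Y (X h).
  have -> : a + b + (c + d) = (a + d) + (b + c) by rewrite (addrC c) addrACA.
  have -> : a' + c + (b + d') = (b + c) + (a' + d').
    by rewrite (addrC b d') addrACA (addrC c) addrC.
  by rewrite addrKA opprD addrACA.
Qed.

Definition bracket (X Y : vfield) : vfield := MkVfield (bracket_derivation X Y).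

End VectorFields.

Section RiemannianGeometry.
Context (R : realType) (m : nat) (M : manifold R m).
Local Notation C := (Cinf M).
Local Notation V := (vfield M).

(* Tensor fields are given by their C-multilinear action on vector fields;    *)
(* a vector field X vanishes at p iff X f p = 0 for every smooth f.           *)
Record riemannian_metric (g : V -> V -> C) : Prop := {
  metricl : forall Z, scalar (g^~ Z);
  metricC : forall X Y, g X Y = g Y X;
  metric_ge0 : forall (X : V) (p : M), 0 <= g X X p;
  metric_eq0 : forall (X : V) (p : M), g X X p = 0 -> forall f : C, X f p = 0 }.

Record affine_connection (D : V -> V -> V) : Prop := {
  connectionl : forall Z, linear (D^~ Z);
  connectionD : forall X Y Z, D X (Y + Z) = D X Y + D X Z;
  connectionM : forall (X : V) (f : C) (Y : V), D X (f *: Y) = X f *: Y + f *: D X Y }.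

Record levi_civita (g : V -> V -> C) (D : V -> V -> V) : Prop := {
  lc_connection : affine_connection D;
  lc_torsion : forall X Y, D X Y - D Y X = bracket X Y;
  lc_metric : forall X Y Z : V, X (g Y Z) = g (D X Y) Z + g Y (D X Z) }.

Definition curvature (D : V -> V -> V) (X Y Z : V) : V :=
  D X (D Y Z) - D Y (D X Z) - D (bracket X Y) Z.

(* At each q in U the values of the E_i form a basis of the tangent space     *)
(* (every tangent vector at q is the value of a global vector field). The     *)
(* E_i are global fields: any local frame near p agrees with global fields on *)
(* a smaller neighbourhood of p.                                              *)
Definition local_frame (U : set M) (E : 'I_m -> V) : Prop :=
  forall q, U q -> forall X : V,
    exists! c : 'rV[R]_m, forall f : C, X f q = \sum_i c 0 i * E i f q.

Definition orthonormal_frame (g : V -> V -> C) (U : set M) (E : 'I_m -> V)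
    : Prop :=
  local_frame U E /\ forall q, U q -> forall i j, g (E i) (E j) q = (i == j)%:R.

(* The two traces below do not depend on the orthonormal frame, so one frame  *)
(* around each point determines S and tau.                                    *)
Definition is_ricci (g : V -> V -> C) (D : V -> V -> V) (S : V -> V -> C)
    : Prop :=
  forall p : M, exists U E, [/\ open_nbhs p U, orthonormal_frame g U E
    & forall X Y q, U q ->
        S X Y q = \sum_i g (curvature D X (E i) (E i)) Y q].

Definition is_scalar_curvature (g : V -> V -> C) (S : V -> V -> C) (tau : C)
    : Prop :=
  forall p : M, exists U E, [/\ open_nbhs p U, orthonormal_frame g U E
    & forall q, U q -> tau q = \sum_i S (E i) (E i) q].

End RiemannianGeometry.

Section ContactGeometry.
Context (R : realType) (n : nat) (M : manifold R (2 * n).+1).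
Local Notation C := (Cinf M).
Local Notation V := (vfield M).
Implicit Types (phi : {linear V -> V}) (xi : V) (eta : {scalar V}).
Implicit Types (g : V -> V -> C) (D : V -> V -> V).

Definition d_eta eta (X Y : V) : C :=
  2^-1 *: (X (eta Y) - Y (eta X) - eta (bracket X Y)).

Record contact_metric phi xi eta g : Prop := {
  contact_riemannian : riemannian_metric g;
  phi_phi : forall X, phi (phi X) = - X + eta X *: xi;
  phi_xi : phi xi = 0;
  eta_phi : forall X, eta (phi X) = 0;
  eta_xi : eta xi = 1;
  metric_phi : forall X Y, g (phi X) (phi Y) = g X Y - eta X * eta Y;
  contact_form : forall X Y, d_eta eta X Y = g X (phi Y) }.

(* kappa *: 1 is the constant function kappa.                                 *)
Definition kappa_nullity xi eta D (kappa : R) : Prop := forall X Y,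
  curvature D X Y xi = (kappa *: (1 : C)) *: (eta Y *: X - eta X *: Y).

Definition tanaka_webster phi xi eta D (X Y : V) : V :=
  D X Y + (X (eta Y) - eta (D X Y)) *: xi - eta Y *: D X xi + eta X *: phi Y.

Definition concircular g D (tau : C) (X1 X2 X3 : V) : V :=
  curvature D X1 X2 X3 -
  (((2 * n * (2 * n).+1)%:R^-1 : R) *: tau) *: (g X2 X3 *: X1 - g X1 X3 *: X2).

Definition phi_concircularly_flat phi g D (tau : C) : Prop :=
  forall X1 X2 X3 X4,
    g (concircular g D tau (phi X1) (phi X2) (phi X3)) (phi X4) = 0.

Definition eta_einstein eta g (S : V -> V -> C) : Prop :=
  exists A B : C, forall X1 X2, S X1 X2 = A * g X1 X2 + B * eta X1 * eta X2.

End ContactGeometry.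

(* Main.v *)
(* The generalized Tanaka-Webster curvature differs from the Riemannian one, on
   horizontal vectors, only by terms built from [phi] and [A X = nabla_X xi], so
   flatness together with the nullity condition determines the whole Riemannian
   curvature tensor in terms of [g], [eta], [phi] and [A].  Tracing it leaves
   multiples of [g] and [eta * eta], a multiple of [g (A X) Y] with coefficient
   [tr A], and [g (A (A X)) Y].  The adjoint of [A] is [phi A phi], whence
   [tr A = 0]; and [R (X, xi) xi] gives [A ^ 2 = - kappa] on horizontal vectors.

   As vector fields are derivations of the algebra of smooth functions, traces
   over a merely local frame need a localization step: a bump function turns the
   local expansion of a field in the frame into one with global smooth
   coefficients. *)
From HB Require Import structures.
Require Import Defs.
From mathcomp Require Import all_boot all_order all_algebra.
From mathcomp Require Import all_classical all_reals all_analysis.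
From mathcomp Require Import ring lra.

Set Implicit Arguments.
Unset Strict Implicit.
Unset Printing Implicit Defensive.

Import Order.TTheory GRing.Theory Num.Theory.
Import numFieldNormedType.Exports.

Local Open Scope classical_set_scope.
Local Open Scope ring_scope.

(** * Bump functions *)

(** The powers of [t^-1] make the family closed under differentiation: the derivative of each member
    is a combination of the next two. *)
Definition flat (R : realType) (n : nat) (t : R) : R :=
  if 0 < t then t^-1 ^+ n * expR (- t^-1) else 0.

(** With [s = t^-1], the exponential series bounds [expR s] below by [s ^+ n.+2 / n.+2!]. The
    quadratic order gives a zero derivative at the origin. *)
Lemma flat_norm_le (R : realType) n (t : R) :
  `|flat n t| <= n.+2`!%:R * t ^+ 2.
Proof.
rewrite /flat; case: ifP => [t0|_]; last first.
  by rewrite normr0 mulr_ge0 ?sqr_ge0.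
have s0 : 0 < t^-1 by rewrite invr_gt0.
rewrite ger0_norm; last by rewrite mulr_ge0 ?expR_ge0// exprn_ge0// ltW.
rewrite expRN ler_pdivrMr ?expR_gt0//.
have := expR_ge1Dxn n.+1 (ltW s0).
move=> /(le_trans _) -/(_ (t^-1 ^+ n.+2 / n.+2`!%:R)).
rewrite lerDr ler01 => /(_ isT).
rewrite ler_pdivrMr ?ltr0n ?fact_gt0// => le_exp.
rewrite mulrAC -ler_pdivrMr ?exprn_gt0// mulrC -exprVn -exprD add2n.
by rewrite mulrC.
Qed.

Lemma is_derive_flat (R : realType) n (t : R) :
  is_derive t 1 (flat n) (- n%:R * flat n.+1 t + flat n.+2 t).
Proof.
have [t0|t0|->] := ltgtP t 0.
- have -> : - n%:R * flat n.+1 t + flat n.+2 t = 0.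
    by rewrite /flat ltNge ltW//= mulr0 addr0.
  apply: (@near_eq_is_derive _ _ _ (cst 0)).
  near=> x; rewrite /flat ltNge ltW//=.
  by near: x; exact: lt_nbhsl.
- rewrite /flat t0.
  have tN0 : t != 0 by rewrite gt_eqF.
  apply: (@near_eq_is_derive _ _ _
      ((fun x : R => x^-1) ^+ n * (expR \o (fun x => - x^-1)))).
    near=> x; rewrite /= !fctE ifT//.
    by near: x; exact: lt_nbhsr.
  have dV : is_derive t 1 (fun x : R => x^-1) (- t ^- 2 *: 1).
    exact: is_deriveV.
  have dE : is_derive t 1 (expR \o (fun x : R => - x^-1)) _ :=
    @is_derive1_comp _ expR (- (fun x : R => x^-1)) _ _ _
      (is_derive_expR (- t^-1)) (is_deriveN dV).
  apply: (is_derive_eq (is_deriveM (is_deriveX n dV) dE)).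
  rewrite /= !fctE /GRing.scale /=.
  rewrite -exprVn; move: (t^-1) => s.
  by case: n => [|n]; rewrite ?exprS; ring.
- have -> : - n%:R * flat n.+1 0 + flat n.+2 0 = 0 :> R.
    by rewrite /flat ltxx mulr0 addr0.
  (* At the origin the difference quotient is bounded by [n.+2!] times the absolute value of [h]. *)
  suff H : (fun h : R => h^-1 *: ((flat n \o shift 0) (h *: 1) - flat n 0))
      @ 0^' --> (0 : R).
    by split; [apply/cvg_ex; exists 0|exact: cvg_lim H].
  apply/cvgr0Pnorm_le => e e0; near=> h.
  have hN0 : h != 0 by near: h; exact: nbhs_dnbhs_neq.
  rewrite /= addr0 /GRing.scale /= mulr1 {2}/flat ltxx subr0 normrM.
  rewrite (le_trans (ler_wpM2l _ (flat_norm_le n h)))//.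
  rewrite -(real_normK (num_real h)) normfV expr2 mulrCA mulKf ?normr_eq0//.
  rewrite -ler_pdivlMl ?ltr0n ?fact_gt0//.
  near: h; apply: dnbhs0_le.
  by rewrite mulr_gt0// invr_gt0 ltr0n fact_gt0.
Unshelve. all: by end_near.
Qed.

Lemma derive_line (R : realType) (V : normedModType R) (f : V -> R) (x e : V) :
  'D_1 (fun h : R => f (h *: e + x)) 0 = 'D_e f x.
Proof.
rewrite /derive; suff -> : (fun h : R => h^-1 *:
    (((fun h => f (h *: e + x)) \o shift 0) (h *: 1) - f (0 *: e + x))) =
    (fun h => h^-1 *: ((f \o shift x) (h *: e) - f x)) by [].
by apply/funext => h; rewrite /= addr0 scale0r add0r /GRing.scale /= mulr1.
Qed.

(* Only the restriction of [f] to the line [x + h e] matters, so the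
   one-dimensional chain rule suffices. *)
Lemma is_derive_comp_dir (R : realType) (V : normedModType R) (f : V -> R)
    (psi : R -> R) (x e : V) (d : R) :
  derivable f x e -> is_derive (f x) 1 psi d ->
  is_derive x e (psi \o f) (d * 'D_e f x).
Proof.
move=> df dpsi; pose u h := f (h *: e + x).
have uE : is_derive (0 : R) 1 u ('D_e f x).
  apply: DeriveDef; last exact: derive_line.
  exact: (derivable1P f x e).1 df.
have dpsi' : is_derive (u 0) 1 psi d by rewrite /u scale0r add0r.
have [dc <-] := is_derive1_comp dpsi' uE; apply: DeriveDef.
  exact: (derivable1P (psi \o f) x e).2 dc.
by rewrite -derive_line.
Qed.

(** The induction on [k] runs over all [n] at once, because differentiating raises the index of
    [flat]. *)
Lemma Ck_on_flat (R : realType) (m n k : nat) (U : set 'rV[R]_m)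
    (f : 'rV[R]_m -> R) :
  open U -> Ck_on k U f -> Ck_on k U (flat n \o f).
Proof.
move=> oU; elim: k n f => [|k IH] n f Cf.
all: have cont x : U x -> {for x, continuous (flat n \o f)} by
  move=> Ux; apply: continuous_comp; [exact: (Ck_on_cont Cf)|];
  apply: differentiable_continuous; apply/derivable1_diffP;
  exact: (@ex_derive _ _ _ _ _ _ _ (is_derive_flat n (f x))).
  by split.
split=> // i; have [df Cdf] := Cf.2 i.
have D x (Ux : U x) := is_derive_comp_dir (df x Ux) (is_derive_flat n (f x)).
split=> [x Ux|]; first by have [] := D x Ux.
have Cf' := Ck_on_pred Cf.
apply: Ck_on_ext oU _ (Ck_on_mul oU (Ck_on_add oU (Ck_on_mul oU
  (Ck_on_cst U k (- n%:R)) (IH n.+1 _ Cf')) (IH n.+2 _ Cf')) Cdf) => x Ux.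
by have [_ ->] := D x Ux.
Qed.

(** [Ck_on] is a pointwise condition on derivatives taken in the whole space, so it glues over
    arbitrary sets. *)
Lemma Ck_on_setU (R : realType) (m k : nat) (U W : set 'rV[R]_m)
    (f : 'rV[R]_m -> R) :
  Ck_on k U f -> Ck_on k W f -> Ck_on k (U `|` W) f.
Proof.
elim: k f => [|k IH] f [cU dU] [cW dW].
  by split=> // x [/cU|/cW].
split=> [x [/cU|/cW]//|i].
have [dUi CUi] := dU i; have [dWi CWi] := dW i.
by split=> [x [/dUi|/dWi]//|]; exact: IH.
Qed.

Lemma Ck_on_subset (R : realType) (m k : nat) (U W : set 'rV[R]_m)
    (f : 'rV[R]_m -> R) :
  U `<=` W -> Ck_on k W f -> Ck_on k U f.
Proof.
move=> UW; elim: k f => [|k IH] f [c d]; first by split=> // x /UW /c.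
split=> [x /UW /c//|i]; have [di Ci] := d i.
by split=> [x /UW /di//|]; exact: IH.
Qed.

Lemma open_param (R : realType) m (T : topologicalType) (c : chart R m T)
    (O : set T) :
  open O -> open [set x | cod c x /\ O (param c x)].
Proof.
move=> oO; rewrite openE => x [cx Ox].
apply: filterI; first exact: open_nbhs_nbhs (conj (cod_open c) cx).
exact: (param_cont cx) (open_nbhs_nbhs (conj oO Ox)).
Qed.

Lemma Ck_on_sqr_dist (R : realType) (m k d : nat) (U : set 'rV[R]_m)
    (y : 'I_d -> 'rV[R]_m -> R) (a : 'I_d -> R) :
  open U -> (forall j, Ck_on k U (y j)) ->
  Ck_on k U (fun x => \sum_j (y j x - a j) ^+ 2).
Proof.
move=> oU Hy; elim: (index_enum _) => [|j s IH].
  apply: Ck_on_ext oU _ (Ck_on_cst U k 0) => x _; by rewrite big_nil.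
have C1 := Ck_on_add oU (Hy j) (Ck_on_cst U k (- a j)).
apply: Ck_on_ext oU _ (Ck_on_add oU (Ck_on_mul oU C1 C1) IH) => x _.
by rewrite big_cons /= expr2.
Qed.

(** In one chart, [flat 0] is applied to [d ^+ 2] minus the squared Euclidean distance to the image
    of [p]. The extension by zero is smooth because the support lies in a compact set, closed by the
    Hausdorff property. *)
Lemma smooth_bump (R : realType) m (M : manifold R m) (p : M) (U : set M) :
  open_nbhs p U ->
  exists b : Cinf M, b p != 0 /\ forall q, ~ U q -> b q = 0.
Proof.
move=> [oU Up]; have [c ac cp] := atlas_cover p.
pose a := Defs.coord c p; have ca : cod c a := coord_cod cp.
have [e e0 ae] : exists2 e, 0 < e &
    ball a e `<=` [set x | cod c x /\ U (param c x)].
  have : nbhs a [set x | cod c x /\ U (param c x)].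
    apply: open_nbhs_nbhs; split; first exact: open_param.
    by split=> //; rewrite coordK.
  by move/nbhs_ballP => -[e e0 ae]; exists e.
pose d := e / 2; have d0 : 0 < d by rewrite divr_gt0.
pose beta (x : 'rV[R]_m) := flat 0 (d ^+ 2 - \sum_j (x 0 j - a 0 j) ^+ 2).
pose B q := if `[< dom c q >] then beta (Defs.coord c q) else 0.
(* This compact cube lies inside the sup-norm ball of radius [e = 2 d] and contains the Euclidean
   ball on which [beta] is nonzero. *)
pose box := [set x : 'rV[R]_m |
  forall j, `[a 0 j - d, a 0 j + d]%classic (x ord0 j)].
have box_ball : box `<=` ball a e.
  move=> x bx; split=> // i j; rewrite (ord1 i) /ball /= ltr_distlC.
  have := bx j; rewrite /= in_itv/= => /andP[l u].
  have de : d < e by rewrite /d; lra.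
  by apply/andP; split; lra.
pose K := param c @` box.
have K_dom q : K q -> dom c q /\ U q.
  by move=> [x /box_ball /ae [cx Ux] <-]; split=> //; exact: param_dom.
have K_closed : closed K.
  apply: compact_closed; first exact: space_hausdorff.
  apply: continuous_compact; last first.
    apply: (@rV_compact _ _ (fun j => `[a 0 j - d, a 0 j + d]%classic)) => j.
    exact: segment_compact.
  apply: continuous_in_subspaceT => x; rewrite inE => /box_ball /ae[cx _].
  exact: param_cont.
have B_K q : B q != 0 -> K q.
  rewrite /B; case: asboolP => [dq|]; last by rewrite eqxx.
  rewrite /beta /flat; case: ltP => [r0 _|]; last by rewrite eqxx.
  exists (Defs.coord c q); last exact: coordK.
  move=> j; rewrite /= in_itv/= -ler_distl.
  rewrite -(@ler_pXn2r _ 2) ?nnegrE ?normr_ge0 ?(ltW d0)//.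
  rewrite real_normK ?num_real//; apply/ltW.
  rewrite subr_gt0 in r0; apply: le_lt_trans r0.
  by rewrite (bigD1 j)//= lerDl sumr_ge0// => i _; exact: sqr_ge0.
have B_smooth : B \in @smooth_fun R m M.
  rewrite unfold_in; apply/asboolP => c' ac' k.
  (* On [W1] the function is [beta] read in the chart [c]; on [W2] it is zero. These open sets cover
     [cod c'], since [K] lies in [dom c]. *)
  pose W1 := [set x | cod c' x /\ dom c (param c' x)].
  pose W2 := [set x | cod c' x /\ (~` K) (param c' x)].
  have oW1 : open W1 by apply: open_param; exact: dom_open.
  have oW2 : open W2 by apply: open_param; exact: closed_openC.
  apply: (@Ck_on_subset _ _ _ _ (W1 `|` W2)).
    move=> x cx; have [Kx|nKx] := pselect (K (param c' x)); [left|by right].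
    by split=> //; have [] := K_dom _ Kx.
  apply: Ck_on_setU; last first.
    apply: Ck_on_ext oW2 _ (Ck_on_cst W2 k 0) => x [_ nK] /=.
    by apply/esym/eqP/negPn/negP => /B_K.
  have S := Ck_on_sqr_dist (a 0) oW1
    (fun j => atlas_compat ac' ac j k).
  have N := Ck_on_mul oW1 (Ck_on_cst W1 k (-1)) S.
  have A := Ck_on_add oW1 (Ck_on_cst W1 k (d ^+ 2)) N.
  apply: Ck_on_ext oW1 _ (Ck_on_flat 0 oW1 A) => x [cx dx] /=.
  by rewrite /B asboolT// /beta mulN1r.
exists (MkCinf B_smooth); split=> [|q nUq] /=.
  rewrite /B asboolT// /beta big1 ?subr0 => [|j _]; last first.
    by rewrite subrr expr0n.
  by rewrite /flat exprn_gt0// expr0 mul1r gt_eqF// expR_gt0.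
by apply/eqP/negPn/negP => /B_K /K_dom[_].
Qed.

(** * Expansion in a local frame *)

Lemma exists_unitmx_rows (F : fieldType) (m : nat) (P : set 'rV[F]_m) :
  (forall c : 'cV[F]_m, (forall v, P v -> v *m c = 0) -> c = 0) ->
  exists2 B : 'M[F]_m, B \in unitmx & forall i, P (row i B).
Proof.
move=> Psep.
suff H k : (k <= m)%N ->
    exists2 B : 'M[F]_(k, m), row_free B & forall i, P (row i B).
  have [B Bfree PB] := H m (leqnn m).
  by exists B => //; rewrite -row_free_unit.
elim: k => [_|k IH km].
  by exists 0 => [|[]//]; rewrite /row_free mxrank0.
have [B Bfree PB] := IH (ltnW km).
(* Fewer than [m] rows leave a nonzero column [c] in their kernel. A row [v] of [P] with [v *m c]
   nonzero is then independent of them. *)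
have [c cN0 Bc] : exists2 c : 'cV[F]_m, c != 0 & B *m c = 0.
  have : kermx B^T != 0.
    by rewrite -mxrank_eq0 mxrank_ker mxrank_tr (eqP Bfree) subn_eq0 -ltnNge.
  move/rowV0Pn => [w /sub_kermxP wB wN0]; exists w^T.
    by rewrite trmx_eq0.
  by rewrite -[B]trmxK -trmx_mul wB trmx0.
have [v Pv vc] : exists2 v, P v & v *m c != 0.
  apply: contrapT => nP; move/eqP: cN0; apply; apply: Psep => v Pv.
  by apply/eqP/negPn/negP => vc; apply: nP; exists v.
have free1 : row_free (col_mx v B).
  apply/inj_row_free => u; rewrite -[u]hsubmxK mul_row_col.
  move: (lsubmx u) (rsubmx u) => s t st0.
  have s0 : s = 0.
    have /eqP := congr1 (mulmx^~ c) st0.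
    rewrite mulmxDl -!mulmxA Bc mulmx0 addr0 mul0mx.
    move: (v *m c) vc => z zN0; rewrite [z]mx11_scalar mul_mx_scalar.
    rewrite scalemx_eq0 => /orP[/eqP z0|/eqP//].
    by move/eqP: zN0; case; rewrite [z]mx11_scalar z0 raddf0.
  move: st0; rewrite s0 mul0mx add0r => tB.
  by rewrite (row_free_inj Bfree (_ : t *m B = 0 *m B)) ?row_mx0 ?mul0mx.
exists (col_mx v B) => // i; case: (split_ordP (i : 'I_(1 + k))) => j ->.
  by rewrite [row _ _](rowKu j v B) [j]ord1 row_id.
by rewrite [row _ _](rowKd j v B).
Qed.

Section Evaluation.
Context (R : realType) (m : nat) (M : manifold R m).

Lemma Cinf_ext (f h : Cinf M) : (forall p, f p = h p) -> f = h.
Proof. by move=> fh; apply: val_inj; apply/funext. Qed.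

(** Named so that it can carry a ring morphism structure, which moves evaluation through sums and
    determinants. *)
Definition eval (p : M) (f : Cinf M) : R := f p.

Lemma eval_zmod_morphism p : zmod_morphism (eval p). Proof. by []. Qed.
HB.instance Definition _ p :=
  GRing.isZmodMorphism.Build (Cinf M) R (eval p) (eval_zmod_morphism p).

Lemma eval_monoid_morphism p : monoid_morphism (eval p). Proof. by []. Qed.
HB.instance Definition _ p :=
  GRing.isMonoidMorphism.Build (Cinf M) R (eval p) (eval_monoid_morphism p).

Lemma Cinf_sumE I (s : seq I) (F : I -> Cinf M) p :
  (\sum_(i <- s) F i) p = \sum_(i <- s) F i p.
Proof. exact: (raddf_sum (eval p)). Qed.

Lemma vfield_sumE I (s : seq I) (F : I -> vfield M) (f : Cinf M) :
  (\sum_(i <- s) F i) f = \sum_(i <- s) F i f.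
Proof.
elim: s => [|i s IH]; first by rewrite !big_nil.
by rewrite !big_cons -IH.
Qed.

(* Cramer's rule in terms of functions separating the frame at [q], cut off by
   a bump function: the coefficients are global smooth functions. *)
Lemma frame_expansion (U : set M) (E : 'I_m -> vfield M) (q : M) :
  open_nbhs q U -> local_frame U E -> forall X : vfield M,
  exists (b : Cinf M) (a : 'I_m -> Cinf M),
    b q != 0 /\ b *: X = \sum_i a i *: E i.
Proof.
move=> Uq frameE X; have [oU qU] := Uq.
pose P : set 'rV[R]_m := [set v | exists f : Cinf M, v = \row_i E i f q].
have [B Bunit PB] : exists2 B : 'M[R]_m, B \in unitmx & forall i, P (row i B).
  apply: exists_unitmx_rows => c Pc.
  (* Both [c] and the zero row expand the zero field at [q]; uniqueness identifies them. *)
  have [c0 [_ c0_uniq]] := frameE q qU (0 : vfield M).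
  have <- : (0 : 'rV[R]_m)^T = c.
    apply: (canLR trmxK); rewrite -(c0_uniq 0) => [|f]; last first.
      by rewrite big1// => i _; rewrite mxE mul0r.
    apply: c0_uniq => f.
    have /matrixP/(_ 0 0) := Pc _ (ex_intro _ f erefl).
    rewrite !mxE => e; apply/esym; rewrite -[RHS]e.
    by apply: eq_bigr => i _; rewrite !mxE mulrC.
  by rewrite trmx0.
have [F EF] : exists F : 'I_m -> Cinf M, forall j i, E i (F j) q = B j i.
  have /choice[F HF] := PB; exists F => j i.
  by have /matrixP/(_ 0 i) := HF j; rewrite !mxE.
(* At [q] this matrix is the invertible [B], so [\det G] does not vanish there, while its adjugate
   has global smooth entries. *)
pose G : 'M[Cinf M]_m := \matrix_(j, i) E i (F j).
have [b0 [b0q b0U]] := smooth_bump Uq.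
exists (b0 * \det G), (fun i => b0 * \sum_j \adj G i j * X (F j)); split.
  have -> : (b0 * \det G) q = b0 q * eval q (\det G) by [].
  rewrite mulf_neq0// -det_map_mx.
  rewrite (_ : map_mx _ _ = B); first by rewrite -unitfE -unitmxE.
  by apply/matrixP => j i; rewrite !mxE; exact: EF.
apply: vfield_ext => f; apply: Cinf_ext => x; rewrite vfield_sumE Cinf_sumE.
have scaleE h (Y : vfield M) : ((b0 * h) *: Y) f x = b0 x * (h x * Y f x).
  by rewrite mulrA.
have [Ux|nUx] := pselect (U x); last first.
  by rewrite big1 => [|i _]; rewrite scaleE b0U// mul0r.
have [c [cX _]] := frameE x Ux X.
rewrite scaleE; under eq_bigr => i _.
  rewrite scaleE.
  rewrite Cinf_sumE.
  over.
rewrite -mulr_sumr; congr (_ * _).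
have adjG i k : \sum_j (\adj G i j) x * E k (F j) x = (\det G) x *+ (i == k).
  have /matrixP/(_ i k) := mul_adj_mx G; rewrite !mxE => e.
  have := congr1 (eval x) e; rewrite raddf_sum raddfMn => <-.
  by apply: eq_bigr => j _; rewrite !mxE.
transitivity (\sum_i \sum_k (c 0 k * E i f x) *
    (\sum_j (\adj G i j) x * E k (F j) x)).
  rewrite cX mulr_sumr; apply: eq_bigr => i _.
  rewrite (bigD1 i)//= adjG eqxx mulr1n big1 ?addr0 => [|k ki].
    by rewrite mulrC.
  by rewrite adjG eq_sym (negPf ki) mulr0.
apply: eq_bigr => i _.
under [in RHS]eq_bigr => j _.
  have -> : (\adj G i j * X (F j)) x = (\adj G i j) x * X (F j) x by [].
  rewrite cX mulr_sumr; over.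
rewrite exchange_big /= mulr_suml; apply: eq_bigr => k _.
rewrite mulr_sumr mulr_suml; apply: eq_bigr => j _; ring.
Qed.

End Evaluation.

(** * Levi-Civita curvature *)

(** Derives a goal from a linear combination [c = d] of known equations, leaving only a [ring]
    identity. *)
Lemma eq_from_sub (V : zmodType) (a b c d : V) : c = d -> a - b = c - d -> a = b.
Proof. by move=> -> /eqP; rewrite subrr subr_eq0 => /eqP. Qed.

Section VectorFieldCalculus.
Context (R : realType) (m : nat) (M : manifold R m).
Implicit Types (X Y Z : vfield M) (f h : Cinf M).

Lemma vfieldD X f h : X (f + h) = X f + X h.
Proof. by have /derivationP[] := vfieldP X. Qed.

Lemma vfieldM X f h : X (f * h) = X f * h + f * X h.
Proof. by have /derivationP[] := vfieldP X. Qed.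

Lemma vfieldZ X (a : R) f : X (a *: f) = a *: X f.
Proof. by have /derivationP[] := vfieldP X. Qed.

Lemma vfield0 X : X 0 = 0.
Proof. by have := vfieldZ X 0 0; rewrite !scale0r. Qed.

Lemma vfieldN X f : X (- f) = - X f.
Proof. by have := vfieldZ X (-1) f; rewrite !scaleN1r. Qed.

Lemma vfield1 X : X 1 = 0.
Proof.
have := vfieldM X 1 1; rewrite !mulr1 mul1r => e.
by apply: (addrI (X 1)); rewrite addr0 -e.
Qed.

Lemma add_vfieldE X Y f : (X + Y) f = X f + Y f. Proof. by []. Qed.

Lemma zero_vfieldE f : (0 : vfield M) f = 0. Proof. by []. Qed.

Lemma opp_vfieldE X f : (- X) f = - X f. Proof. by []. Qed.

Lemma scale_vfieldE h X f : (h *: X) f = h * X f. Proof. by []. Qed.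

Lemma bracketE X Y f : bracket X Y f = X (Y f) - Y (X f). Proof. by []. Qed.

Definition vfieldE :=
  (add_vfieldE, opp_vfieldE, scale_vfieldE, bracketE, vfieldD, vfieldN, vfieldM).

Lemma bracketC X Y : bracket X Y = - bracket Y X.
Proof. by apply: vfield_ext => f; rewrite !vfieldE opprB. Qed.

Lemma bracketZl f X Y : bracket (f *: X) Y = f *: bracket X Y - Y f *: X.
Proof. by apply: vfield_ext => h; rewrite !vfieldE; ring. Qed.

Lemma jacobi X Y Z :
  bracket X (bracket Y Z) + bracket Y (bracket Z X) + bracket Z (bracket X Y) = 0.
Proof.
apply: vfield_ext => f; rewrite zero_vfieldE !vfieldE; ring.
Qed.

Lemma bracketDl X X' Y : bracket (X + X') Y = bracket X Y + bracket X' Y.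
Proof. by apply: vfield_ext => h; rewrite !vfieldE; ring. Qed.

Lemma Cinf_double_eq0 f : f + f = 0 -> f = 0.
Proof.
move=> f0; apply: Cinf_ext => p; have := congr1 (eval p) f0.
by rewrite /eval; change (f p + f p = 0 -> f p = 0); lra.
Qed.

End VectorFieldCalculus.

Section Metric.
Context (R : realType) (m : nat) (M : manifold R m).
Context (g : vfield M -> vfield M -> Cinf M) (g_metric : riemannian_metric g).
Implicit Types (X Y Z W : vfield M) (f h : Cinf M).

Lemma metricDl X Y Z : g (X + Y) Z = g X Z + g Y Z.
Proof. by have := metricl g_metric Z 1 X Y; rewrite /= scale1r mul1r. Qed.

Lemma metric0l Z : g 0 Z = 0.
Proof. by apply: (addrI (g 0 Z)); rewrite -metricDl !addr0. Qed.

Lemma metricZl f X Z : g (f *: X) Z = f * g X Z.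
Proof. by have := metricl g_metric Z f X 0; rewrite /= metric0l !addr0. Qed.

Lemma metricNl X Z : g (- X) Z = - g X Z.
Proof. by rewrite -scaleN1r metricZl mulN1r. Qed.

Lemma metric0r Z : g Z 0 = 0.
Proof. by rewrite (metricC g_metric) metric0l. Qed.

Lemma metricDr X Y Z : g Z (X + Y) = g Z X + g Z Y.
Proof. by rewrite !(metricC g_metric Z) metricDl. Qed.

Lemma metricZr f X Z : g Z (f *: X) = f * g Z X.
Proof. by rewrite !(metricC g_metric Z) metricZl. Qed.

Lemma metricNr X Z : g Z (- X) = - g Z X.
Proof. by rewrite !(metricC g_metric Z) metricNl. Qed.

Definition metricE := (metricDl, metricZl, metricNl, metric0l,
  metricDr, metricZr, metricNr, metric0r).

Lemma metric_inj X Y : (forall Z, g X Z = g Y Z) -> X = Y.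
Proof.
move=> gXY; apply/subr0_eq/vfield_ext => f; apply: Cinf_ext => p.
apply: (metric_eq0 g_metric); by rewrite metricDl metricNl gXY subrr.
Qed.

(** Applying [L] to the expansion of [b *: X] and cancelling [b q] reduces the claim to the
    coefficients, which come from the same expansion with [g^~ (E i)] for [L]. *)
Lemma scalar_orthonormal_frame (U : set M) (E : 'I_m -> vfield M) (q : M)
    (L : vfield M -> Cinf M) X :
  scalar L -> open_nbhs q U -> orthonormal_frame g U E ->
  L X q = \sum_i g X (E i) q * L (E i) q.
Proof.
move=> Llin Uq [frameE orthoE]; have qU := Uq.2.
have [b [a [bq bX]]] := frame_expansion Uq frameE X.
have L0 : L 0 = 0.
  have := Llin 1 0 0; rewrite /= scale1r addr0 mul1r => L0.
  by apply: (addrI (L 0)); rewrite addr0 -L0.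
have expand (L' : vfield M -> Cinf M) : L' 0 = 0 -> scalar L' ->
    b q * L' X q = \sum_i a i q * L' (E i) q.
  move=> L'0 L'lin.
  have L'Z f Y : L' (f *: Y) = f * L' Y.
    by have := L'lin f Y 0; rewrite /= L'0 !addr0.
  transitivity (L' (b *: X) q); first by rewrite L'Z.
  rewrite bX; elim: (index_enum _) => [|i s IH]; first by rewrite !big_nil L'0.
  rewrite !big_cons -IH.
  transitivity ((a i * L' (E i) + L' (\sum_(i <- s) a i *: E i)) q) => //.
  by rewrite -L'lin.
have aE i : a i q = b q * g X (E i) q.
  rewrite (expand (g^~ (E i)) (metric0l _) (metricl g_metric _)) (bigD1 i)//= big1.
    by rewrite orthoE// eqxx mulr1 addr0.
  by move=> j ji; rewrite orthoE// (negPf ji) mulr0.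
apply: (mulfI bq); rewrite (expand L L0 Llin) mulr_sumr.
by apply: eq_bigr => i _; rewrite aE mulrA.
Qed.

End Metric.

Section LeviCivita.
Context (R : realType) (m : nat) (M : manifold R m).
Context (g : vfield M -> vfield M -> Cinf M) (D : vfield M -> vfield M -> vfield M).
Context (g_metric : riemannian_metric g) (lcD : levi_civita g D).
Implicit Types (X Y Z W : vfield M) (f h : Cinf M).

Let conD := lc_connection lcD.

Lemma connDl X Y Z : D (X + Y) Z = D X Z + D Y Z.
Proof. by have := connectionl conD Z 1 X Y; rewrite /= !scale1r. Qed.

Lemma conn0l Z : D 0 Z = 0.
Proof. by apply: (addrI (D 0 Z)); rewrite -connDl !addr0. Qed.

Lemma connZl f X Z : D (f *: X) Z = f *: D X Z.
Proof. by have := connectionl conD Z f X 0; rewrite /= conn0l !addr0. Qed.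

Lemma connNl X Z : D (- X) Z = - D X Z.
Proof. by rewrite -scaleN1r connZl scaleN1r. Qed.

Lemma connDr X Y Z : D X (Y + Z) = D X Y + D X Z.
Proof. exact: connectionD conD _ _ _. Qed.

Lemma connZr X f Y : D X (f *: Y) = X f *: Y + f *: D X Y.
Proof. exact: connectionM conD _ _ _. Qed.

Lemma conn0r X : D X 0 = 0.
Proof. by apply: (addrI (D X 0)); rewrite -connDr !addr0. Qed.

Lemma connNr X Y : D X (- Y) = - D X Y.
Proof. by apply: (addrI (D X Y)); rewrite -connDr !subrr conn0r. Qed.

Definition connE := (connDl, connZl, connNl, conn0l, connDr, connZr, connNr, conn0r).

(** Vanishing torsion turns the cyclic sum into the Jacobi identity. *)
Lemma curvature_bianchi X Y Z :
  curvature D X Y Z + curvature D Y Z X + curvature D Z X Y = 0.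
Proof.
have T A B : D A B = D B A + bracket A B by rewrite -(lc_torsion lcD) addrC subrK.
rewrite -[RHS](jacobi X Y Z) /curvature.
rewrite (T (bracket X Y) Z) (T (bracket Y Z) X) (T (bracket Z X) Y).
rewrite (bracketC _ Z) (bracketC _ X) (bracketC _ Y) -!(lc_torsion lcD).
rewrite !connE; apply: vfield_ext => f; rewrite !(add_vfieldE, opp_vfieldE).
ring.
Qed.

Definition Rm X Y Z W : Cinf M := g (curvature D X Y Z) W.

Lemma RmC12 X Y Z W : Rm X Y Z W = - Rm Y X Z W.
Proof.
by rewrite /Rm /curvature (bracketC X Y) !connE !(metricE g_metric); ring.
Qed.

(** Metric compatibility expands both sides of the definition of [bracket X Y] acting on [g Z W]. *)
Lemma RmC34 X Y Z W : Rm X Y Z W = - Rm X Y W Z.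
Proof.
have H (A B : vfield M) : A (B (g Z W)) = g (D A (D B Z)) W + g (D B Z) (D A W) +
    (g (D A Z) (D B W) + g Z (D A (D B W))).
  by rewrite (lc_metric lcD) vfieldD !(lc_metric lcD).
have := bracketE X Y (g Z W); rewrite (lc_metric lcD) !H.
rewrite [g Z (D (bracket _ _) _)](metricC g_metric).
rewrite [g Z (D X (D _ _))](metricC g_metric) [g Z (D Y (D _ _))](metricC g_metric).
move/esym/eq_from_sub; apply; rewrite /Rm /curvature !(metricE g_metric); ring.
Qed.

Lemma Rm_bianchi X Y Z W : Rm X Y Z W + Rm Y Z X W + Rm Z X Y W = 0.
Proof. by rewrite /Rm -!(metricDl g_metric) curvature_bianchi (metric0l g_metric). Qed.

(** In a signed sum of four Bianchi identities, the two antisymmetries leave only twice the required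
    difference. *)
Lemma Rm_pair X Y Z W : Rm X Y Z W = Rm Z W X Y.
Proof.
apply/subr0_eq/Cinf_double_eq0.
have e1 := Rm_bianchi X Y Z W; have e2 := Rm_bianchi Y Z W X.
have e3 := Rm_bianchi Z W X Y; have e4 := Rm_bianchi W X Y Z.
have : (Rm X Y Z W + Rm Y Z X W + Rm Z X Y W) +
  (Rm Y Z W X + Rm Z W Y X + Rm W Y Z X) -
  (Rm Z W X Y + Rm W X Z Y + Rm X Z W Y) -
  (Rm W X Y Z + Rm X Y W Z + Rm Y W X Z) = 0.
  by rewrite e1 e2 e3 e4 !subr0 addr0.
rewrite (RmC34 Y Z W X) (RmC34 Z W Y X) (RmC34 W X Z Y) (RmC34 X Y W Z).
rewrite (RmC12 Z X Y W) (RmC34 X Z Y W) (RmC12 W Y Z X) (RmC34 Y W Z X).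
move/eq_from_sub; apply; ring.
Qed.

Lemma Rm_lin1 f X X' Y Z W : Rm (f *: X + X') Y Z W = f * Rm X Y Z W + Rm X' Y Z W.
Proof.
rewrite /Rm /curvature bracketDl bracketZl !connE !(metricE g_metric); ring.
Qed.

Lemma Rm_lin2 f X Y Y' Z W : Rm X (f *: Y + Y') Z W = f * Rm X Y Z W + Rm X Y' Z W.
Proof. by rewrite RmC12 Rm_lin1 (RmC12 Y) (RmC12 Y'); ring. Qed.

Lemma Rm_lin3 f X Y Z Z' W : Rm X Y (f *: Z + Z') W = f * Rm X Y Z W + Rm X Y Z' W.
Proof. by rewrite Rm_pair Rm_lin1 -!(Rm_pair X Y). Qed.

Lemma Rm_lin4 f X Y Z W W' : Rm X Y Z (f *: W + W') = f * Rm X Y Z W + Rm X Y Z W'.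
Proof. by rewrite /Rm (metricDr g_metric) (metricZr g_metric). Qed.

End LeviCivita.

(** * Contact metric geometry *)

Section Contact.
Context (R : realType) (n : nat) (M : manifold R (2 * n).+1).
Context (phi : {linear vfield M -> vfield M}) (xi : vfield M)
  (eta : {scalar vfield M}) (g : vfield M -> vfield M -> Cinf M)
  (D : vfield M -> vfield M -> vfield M) (kappa : R).
Context (contact : contact_metric phi xi eta g) (lcD : levi_civita g D)
  (nullity : kappa_nullity xi eta D kappa).
Implicit Types (X Y Z W : vfield M) (f h : Cinf M).

Let gm : riemannian_metric g := contact_riemannian contact.
Let gC := metricC gm.
Let gE := metricE gm.
Let DE := connE lcD.
Let D_metric := lc_metric lcD.

Local Notation A X := (D X xi).
Local Notation k := (kappa *: (1 : Cinf M)).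

Lemma contact_etaE X : eta X = g X xi.
Proof.
have := metric_phi contact X xi.
by rewrite (phi_xi contact) (eta_xi contact) (metric0r gm) mulr1 => /esym/subr0_eq.
Qed.

Lemma contact_metric_xi : g xi xi = 1.
Proof. by rewrite -contact_etaE (eta_xi contact). Qed.

Lemma contact_phi_xi X : g (phi X) xi = 0.
Proof. by rewrite -contact_etaE (eta_phi contact). Qed.

Lemma contact_phi_phi X : phi (phi X) = - X + g X xi *: xi.
Proof. by rewrite (phi_phi contact) contact_etaE. Qed.

Lemma contact_phi_skew X Y : g (phi X) Y = - g X (phi Y).
Proof.
have := metric_phi contact X (phi Y).
rewrite (eta_phi contact) mulr0 subr0 => <-.
by rewrite contact_phi_phi !gE contact_phi_xi mulr0 addr0 opprK.
Qed.

Lemma contact_form_double X Y :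
  X (eta Y) - Y (eta X) - eta (bracket X Y) = g X (phi Y) + g X (phi Y).
Proof.
rewrite -(contact_form contact) /d_eta -scalerDl.
have -> : 2^-1 + 2^-1 = 1 :> R by lra.
by rewrite scale1r.
Qed.

Lemma connection_xi_eta X : g (A X) xi = 0.
Proof.
apply: Cinf_double_eq0; rewrite -{2}[g (A X) xi]gC.
by rewrite -D_metric contact_metric_xi vfield1.
Qed.

(** Since the torsion vanishes, the left side is twice the exterior derivative of [eta], the form
    dual to [xi]. *)
Lemma connection_xi_skew X Y :
  g (A X) Y - g (A Y) X = g X (phi Y) + g X (phi Y).
Proof.
rewrite -contact_form_double !contact_etaE -(lc_torsion lcD) !D_metric !gE.
by rewrite (gC Y) (gC X (A Y)); ring.
Qed.

Lemma connection_xi_xi : A xi = 0.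
Proof.
apply: (metric_inj gm) => Y; have := connection_xi_skew xi Y.
rewrite connection_xi_eta (gC xi) contact_phi_xi addr0 => /subr0_eq ->.
by rewrite (metric0l gm).
Qed.

(* The Lie derivative of [eta] along [xi] vanishes, hence so does that of its
   exterior derivative. *)
Lemma xi_contact_form X Y :
  xi (g X (phi Y)) = g (bracket xi X) (phi Y) + g X (phi (bracket xi Y)).
Proof.
(* The case [X = xi] of the contact condition: the Lie derivative of [eta] along [xi] vanishes. *)
have eta_bracket Z : eta (bracket xi Z) = xi (eta Z).
  have := contact_form_double xi Z.
  rewrite (eta_xi contact) vfield1 (gC xi) contact_phi_xi addr0 subr0.
  by move/subr0_eq.
apply/subr0_eq/Cinf_double_eq0.
have J : eta (bracket (bracket xi X) Y) + eta (bracket X (bracket xi Y)) =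
    xi (eta (bracket X Y)).
  rewrite -eta_bracket -raddfD; congr (eta _).
  by apply: vfield_ext => f; rewrite !vfieldE; ring.
have E1 := congr1 xi (contact_form_double X Y).
have E2 := contact_form_double (bracket xi X) Y.
have E3 := contact_form_double X (bracket xi Y).
move: E1 E2 E3; rewrite !vfieldE !eta_bracket -J => E1 E2 E3.
have E := congr2 +%R E1 (congr2 +%R (congr1 -%R E2) (congr1 -%R E3)).
by apply: eq_from_sub (esym E) _; ring.
Qed.

(** The covariant derivative of [phi] along [xi]; [connection_phi_xi] shows that it vanishes. *)
Let phi_deriv Y := D xi (phi Y) - phi (D xi Y).

Let phi_derivE X Y : g X (phi_deriv Y) = g (phi X) (A Y) - g (A X) (phi Y).
Proof.
have := xi_contact_form X Y; rewrite D_metric -!(lc_torsion lcD) !raddfB /=.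
rewrite /phi_deriv !gE (contact_phi_skew X) => E.
by apply: eq_from_sub E _; ring.
Qed.

(** Differentiate the formula for [phi] squared along [xi]; its right side is parallel in that
    direction, as [A xi = 0]. *)
Let phi_deriv_anti Y : phi_deriv (phi Y) = - phi (phi_deriv Y).
Proof.
rewrite /phi_deriv !contact_phi_phi raddfB /= contact_phi_phi !DE.
rewrite connection_xi_xi scaler0 addr0 D_metric connection_xi_xi (metric0r gm) addr0.
by apply: vfield_ext => f; rewrite !(add_vfieldE, opp_vfieldE, scale_vfieldE); ring.
Qed.

(* This says that the tensor [h] anticommutes with [phi], since
   [A X = - phi X - phi (h X)]. *)
Lemma connection_xi_phi X Y : g (A (phi X)) (phi Y) = - g (A Y) X.
Proof.
apply/subr0_eq/Cinf_double_eq0; rewrite opprK.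
(* Expanded by [phi_derivE], this combines with the skew parts of [A] at [X], [Y] and at [phi X],
   [phi Y] to give twice the claim. *)
have E1 : g X (phi_deriv (phi Y)) = g (phi X) (phi_deriv Y).
  by rewrite phi_deriv_anti contact_phi_skew (metricNr gm).
have E2 := connection_xi_skew X Y.
have E3 := connection_xi_skew (phi X) (phi Y).
move: E1 E2 E3; rewrite !phi_derivE !contact_phi_phi !gE (gC xi) !connection_xi_eta.
rewrite contact_phi_xi (contact_phi_skew X Y) (gC (phi X)) (gC X (A Y)).
move=> E1 E2 E3.
have E := congr2 +%R E1 (congr2 +%R (congr1 -%R E2) E3).
by apply: eq_from_sub E _; ring.
Qed.

(** [phi_deriv] kills the image of [phi] by [connection_xi_phi], and kills multiples of [xi] as
    [A xi = 0]; together these span all fields. *)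
Lemma connection_phi_xi Y : D xi (phi Y) = phi (D xi Y).
Proof.
apply/subr0_eq; rewrite -/(phi_deriv Y).
have P0 Z : phi_deriv (phi Z) = 0.
  apply: (metric_inj gm) => X; rewrite (metric0l gm) gC phi_derivE (gC _ (A _)).
  by rewrite connection_xi_phi contact_phi_phi !gE connection_xi_eta; ring.
have PD Z Z' : phi_deriv (Z + Z') = phi_deriv Z + phi_deriv Z'.
  by rewrite /phi_deriv !(raddfD, connDr lcD) /= addrACA.
have Y_split : Y = phi (- phi Y) + g Y xi *: xi.
  by rewrite raddfN /= contact_phi_phi opprD opprK subrK.
rewrite Y_split PD P0 add0r /phi_deriv linearZ /= (phi_xi contact) scaler0.
rewrite (conn0r lcD) (connZr lcD) connection_xi_xi scaler0 addr0.
by rewrite linearZ /= (phi_xi contact) scaler0 subrr.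
Qed.

(** A Riccati equation for [A] along [xi]: the nullity condition for [R (X, xi) xi], with the
    bracket rewritten by vanishing torsion. *)
Lemma xi_sectional X Y : g (D xi (A X)) Y - g (A (D xi X)) Y =
  - g (A (A X)) Y - k * (g X Y - g X xi * g Y xi).
Proof.
have nul : curvature D X xi xi = k *: (eta xi *: X - eta X *: xi) := nullity X xi.
have := congr1 (g^~ Y) nul.
rewrite /curvature connection_xi_xi !contact_etaE contact_metric_xi.
rewrite -(lc_torsion lcD) !DE !gE (gC xi Y) => E.
by apply: eq_from_sub (esym E) _; move: k => c; ring.
Qed.

(* [phi A phi] is the adjoint of [A]. *)
Lemma connection_xi_adj X Y : g (phi (A (phi X))) Y = g X (A Y).
Proof. by rewrite contact_phi_skew connection_xi_phi opprK gC. Qed.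

(* Conjugating [xi_sectional] by [phi] turns [A] into its adjoint and flips the
   sign of [A ^ 2], so that the [xi]-derivative of [A] cancels. *)
Lemma connection_xi_sqr X Y :
  g (A (A X)) Y = - k * (g X Y - g X xi * g Y xi).
Proof.
have A_phi_phi Z : A (phi (phi Z)) = - A Z.
  by rewrite contact_phi_phi !DE connection_xi_xi scaler0 addr0.
have E1 := xi_sectional X Y.
have E2 := xi_sectional (phi Y) (phi X).
have skew Z W : g Z (phi W) = - g (phi Z) W by rewrite contact_phi_skew opprK.
(* As [phi A phi] is the adjoint of [A], its derivative along [xi] is computed from that of [A]. *)
have E3 : g (D xi (phi (A (phi Y)))) X = xi (g Y (A X)) - g Y (A (D xi X)).
  by rewrite -connection_xi_adj D_metric -connection_xi_adj addrK.
have E4 : g (phi (A (A (phi Y)))) X = - g Y (A (A X)).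
  by rewrite -!connection_xi_adj A_phi_phi raddfN (metricNl gm) opprK.
move: E2; rewrite connection_phi_xi !(skew _ X) connection_xi_adj E4.
rewrite -connection_phi_xi E3 -skew (metric_phi contact) !contact_phi_xi D_metric.
rewrite !contact_etaE !(gC Y) (gC xi Y) => E2.
apply/subr0_eq/Cinf_double_eq0.
by apply: eq_from_sub (congr2 +%R E1 E2) _; move: k => c; ring.
Qed.

(** * Curvature of the Tanaka-Webster connection *)

(** On horizontal fields the new connection is the horizontal projection of [D], whose second
    derivatives give the products of [A] terms. The [phi Z] term comes from the [xi] component of
    [bracket X Y]. *)
Lemma tanaka_webster_curvature X Y Z W :
  g X xi = 0 -> g Y xi = 0 -> g Z xi = 0 -> g W xi = 0 ->
  g (curvature (tanaka_webster phi xi eta D) X Y Z) W =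
  g (curvature D X Y Z) W + g (A Y) Z * g (A X) W - g (A X) Z * g (A Y) W
  + (g X (phi Y) + g X (phi Y)) * g (phi Z) W.
Proof.
move=> X0 Y0 Z0 W0; set T := tanaka_webster phi xi eta D.
have TE B Z' : g Z' xi = 0 -> g B xi = 0 ->
    T B Z' = D B Z' + g (A B) Z' *: xi.
  move=> Z'0 B0; rewrite /T /tanaka_webster !contact_etaE Z'0 B0 vfield0 sub0r.
  rewrite !scale0r oppr0 !addr0.
  have := D_metric B Z' xi; rewrite Z'0 vfield0 => /esym/eqP.
  by rewrite addr_eq0 => /eqP ->; rewrite opprK gC.
have T_xi B Z' : g Z' xi = 0 -> g B xi = 0 -> g (T B Z') xi = 0.
  move=> Z'0 B0; rewrite TE// !gE contact_metric_xi mulr1.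
  by rewrite (gC _ Z') -D_metric Z'0 vfield0.
have TT B B' : g B xi = 0 -> g B' xi = 0 ->
    g (T B (T B' Z)) W = g (D B (D B' Z)) W + g (A B') Z * g (A B) W.
  move=> B0 B'0; rewrite TE ?T_xi// TE// !DE !gE (gC xi) W0 !mulr0 add0r addr0.
  by [].
have bracket_xi : g (bracket X Y) xi = - (g X (phi Y) + g X (phi Y)).
  rewrite -contact_form_double !contact_etaE X0 Y0 !vfield0.
  by rewrite subrr sub0r opprK.
have T_bracket : g (T (bracket X Y) Z) W =
    g (D (bracket X Y) Z) W - (g X (phi Y) + g X (phi Y)) * g (phi Z) W.
  rewrite /T /tanaka_webster !contact_etaE Z0 bracket_xi !gE (gC xi) W0.
  ring.
clearbody T; rewrite /curvature !gE !TT// T_bracket; ring.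
Qed.

Lemma Rm_xi3 X Y W : Rm g D X Y xi W = k * (g Y xi * g X W - g X xi * g Y W).
Proof.
have nul : curvature D X Y xi = k *: (eta Y *: X - eta X *: Y) := nullity X Y.
by rewrite /Rm nul !contact_etaE !gE.
Qed.

Lemma Rm_xi4 X Y Z : Rm g D X Y Z xi = - k * (g Y xi * g X Z - g X xi * g Y Z).
Proof. by rewrite (RmC34 gm lcD) Rm_xi3 mulNr. Qed.

Lemma Rm_xi1 Y Z W : Rm g D xi Y Z W = k * (g W xi * g Z Y - g Z xi * g W Y).
Proof. by rewrite (Rm_pair gm lcD) Rm_xi3. Qed.

Lemma Rm_xi2 X Z W : Rm g D X xi Z W = - k * (g W xi * g Z X - g Z xi * g W X).
Proof. by rewrite (RmC12 gm lcD) Rm_xi1 mulNr. Qed.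

(** Flatness gives the curvature of horizontal projections; multilinearity reaches all fields, the
    slots filled by [xi] being settled by nullity. Here [h] is the horizontal part of the metric,
    not the contact tensor of that name. *)
Lemma phi_concircularly_flat_Rm (tau : Cinf M) :
  phi_concircularly_flat phi g (tanaka_webster phi xi eta D) tau ->
  let c : Cinf M := ((2 * n * (2 * n).+1)%:R^-1 : R) *: tau in
  let h X Y := g X Y - g X xi * g Y xi in
  forall X Y Z W, Rm g D X Y Z W =
    c * (h Y Z * h X W - h X Z * h Y W)
    - g (A Y) Z * g (A X) W + g (A X) Z * g (A Y) W
    - (g X (phi Y) + g X (phi Y)) * g (phi Z) W
    + k * (h X W * (g Y xi * g Z xi) + h Y Z * (g X xi * g W xi)
           - h X Z * (g Y xi * g W xi) - h Y W * (g X xi * g Z xi)).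
Proof.
move=> flat c h X Y Z W.
(* The horizontal projection, equal to [phi (phi (- V))], so the fields [phi (- V)] are the right
   inputs for flatness. *)
pose H V := - g V xi *: xi + V.
have HE V : phi (phi (- V)) = H V.
  by rewrite contact_phi_phi opprK !gE addrC.
have H_xi V : g (H V) xi = 0 by rewrite -HE contact_phi_xi.
have gH V V' : g (H V) (H V') = h V V'.
  by rewrite /H /h !gE contact_metric_xi (gC xi); ring.
have AH V : A (H V) = A V by rewrite /H !DE connection_xi_xi scaler0 add0r.
have gAH V V' : g (A V) (H V') = g (A V) V'.
  by rewrite /H !gE connection_xi_eta mulr0 add0r.
have phiH V : phi (H V) = phi V.
  by rewrite /H linearD linearZ /= (phi_xi contact) scaler0 add0r.
have gphiH V V' : g (phi V) (H V') = g (phi V) V'.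
  by rewrite /H !gE contact_phi_xi mulr0 add0r.
have H_def V : H V = - g V xi *: xi + V by [].
clearbody H; have := flat (phi (- X)) (phi (- Y)) (phi (- Z)) (phi (- W)).
rewrite /concircular !HE -/c (metricDl gm) tanaka_webster_curvature//.
rewrite -/(Rm g D (H X) (H Y) (H Z) (H W)) !gE.
rewrite !AH !phiH !gAH !gphiH (gC (H X) (phi Y)) gphiH (gC (phi Y)) !gH.
rewrite !H_def.
rewrite !((Rm_lin1 gm lcD), (Rm_lin2 gm lcD), (Rm_lin3 gm lcD), (Rm_lin4 _ gm)).
rewrite !(Rm_xi1, Rm_xi2, Rm_xi3, Rm_xi4) !contact_metric_xi !(gC xi).
move=> E; apply: eq_from_sub E _; rewrite /h.
rewrite (gC Z X) (gC Z Y) (gC W X) (gC W Y).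
move: c k => c k'.
ring.
Qed.
End Contact.

(** * Traces over a frame and the Ricci tensor *)

(** Expanding the inner field in the frame gives a double sum symmetric under exchange of [P] and
    [Q]. *)
Lemma trace_comp (R : realType) (m : nat) (M : manifold R m)
    (g : vfield M -> vfield M -> Cinf M) (U : set M) (E : 'I_m -> vfield M)
    (q : M) (P Q : vfield M -> vfield M) :
  riemannian_metric g -> open_nbhs q U -> orthonormal_frame g U E ->
  linear P -> linear Q ->
  \sum_i g (P (Q (E i))) (E i) q = \sum_i g (Q (P (E i))) (E i) q.
Proof.
move=> gm Uq orthoE.
have expand (P' Q' : vfield M -> vfield M) : linear P' ->
    \sum_i g (P' (Q' (E i))) (E i) q =
    \sum_i \sum_j g (Q' (E i)) (E j) q * g (P' (E j)) (E i) q.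
  move=> P'lin; apply: eq_bigr => i _.
  apply: (@scalar_orthonormal_frame _ _ _ _ gm _ _ _
    (fun X => g (P' X) (E i)) _ _ Uq orthoE).
  by move=> f X Y /=; rewrite P'lin (metricl gm).
move=> Plin Qlin; rewrite (expand P Q Plin) (expand Q P Qlin) exchange_big /=.
by apply: eq_bigr => i _; apply: eq_bigr => j _; rewrite mulrC.
Qed.

Theorem theorem3 (R : realType) (n : nat) (M : manifold R (2 * n).+1)
    (phi : {linear vfield M -> vfield M}) (xi : vfield M)
    (eta : {scalar vfield M}) (g : vfield M -> vfield M -> Cinf M)
    (nabla : vfield M -> vfield M -> vfield M) (kappa : R)
    (S S0 : vfield M -> vfield M -> Cinf M) (tau0 : Cinf M) :
  (1 <= n)%N ->
  contact_metric phi xi eta g ->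
  levi_civita g nabla ->
  kappa_nullity xi eta nabla kappa ->
  is_ricci g nabla S ->
  is_ricci g (tanaka_webster phi xi eta nabla) S0 ->
  is_scalar_curvature g S0 tau0 ->
  phi_concircularly_flat phi g (tanaka_webster phi xi eta nabla) tau0 ->
  eta_einstein eta g S.
Proof.
move=> _ contact lcD nullity ricciS _ _ flat.
have gm := contact_riemannian contact; have gC := metricC gm.
have := phi_concircularly_flat_Rm contact lcD nullity flat.
have := connection_xi_sqr contact lcD nullity.
move: (kappa *: (1 : Cinf M)) => k AE /=; move: (_ *: tau0) => c RmE.
(* The coefficient of [g X W] left by the trace, that is [(2 n - 1) c - 2]. The other coefficient
   then makes [S xi xi] equal to [2 n k]. *)
pose a : Cinf M := (2 * n)%:R * c - c - 1 - 1.
exists a, ((2 * n)%:R * k - a) => X W; rewrite !(contact_etaE contact).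
apply: Cinf_ext => q; have [U [E [Uq orthoE SE]]] := ricciS q.
have qU := Uq.2; rewrite SE//.
have gsum Y Z : \sum_i g Y (E i) q * g (E i) Z q = g Y Z q.
  apply/esym.
  apply: (@scalar_orthonormal_frame _ _ _ _ gm _ _ _ (g^~ Z) _ _ Uq orthoE).
  exact: metricl gm Z.
have gEE i : g (E i) (E i) q = 1 by rewrite orthoE.2// eqxx.
(* Cyclicity for [phi] and [A phi]: one composite is the adjoint of [A], the other has the trace of
   [- A], so [tr A = - tr A]. *)
have trace0 : \sum_i g (nabla (E i) xi) (E i) q = 0.
  have phiC : linear phi by move=> f Y Z; rewrite linearP.
  have AphiC : linear (fun Y => nabla (phi Y) xi).
    by move=> f Y Z; rewrite linearP (connectionl (lc_connection lcD)).
  have := trace_comp gm Uq orthoE phiC AphiC.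
  under eq_bigr do rewrite (connection_xi_adj contact lcD) gC.
  under [in RHS]eq_bigr => i _.
    rewrite (contact_phi_phi contact) (connDl lcD) (connZl lcD) (connNl lcD).
    rewrite (connection_xi_xi contact lcD) scaler0 addr0 (metricNl gm).
    over.
  rewrite -(Cinf_sumE _ (fun i => g (nabla (E i) xi) (E i))).
  rewrite -(Cinf_sumE _ (fun i => - g (nabla (E i) xi) (E i))) sumrN.
  set s := \sum_i _; change ((- s) q) with (- s q); lra.
(* The adjoint of [A] applied to [W], which brings [g (A (E i)) W] into the form contracted by
   [gsum]. *)
pose adj := phi (nabla (phi W) xi).
have AA : g (nabla X xi) adj q =
    - k q * (g X W q - g X xi q * g W xi q).
  have -> : g (nabla X xi) adj = g (nabla (nabla X xi) xi) W.
    by rewrite gC (connection_xi_adj contact lcD) gC.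
  by rewrite AE.
have phi_phi_q : g (phi X) (phi W) q = g X W q - g X xi q * g W xi q.
  by rewrite (metric_phi contact) !(contact_etaE contact).
(* The part independent of [i], kept opaque so that [big_split] does not break it up and summation
   only multiplies it by [2 n + 1]. *)
have [C0 C0E] : exists C0, C0 =
    c q * (g X W q - g X xi q * g W xi q) + k q * g X xi q * g W xi q.
  by eexists.
have term i : g (curvature nabla X (E i) (E i)) W q =
    C0 + (k q - c q) * g X W q * (g xi (E i) q * g (E i) xi q)
    - c q * (g X (E i) q * g (E i) W q)
    + (c q - k q) * g W xi q * (g X (E i) q * g (E i) xi q)
    + (c q - k q) * g X xi q * (g xi (E i) q * g (E i) W q)
    - g (nabla X xi) W q * g (nabla (E i) xi) (E i) q
    + g (nabla X xi) (E i) q * g (E i) adj q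
    - 2 * (g (phi X) (E i) q * g (E i) (phi W) q).
  transitivity (Rm g nabla X (E i) (E i) W q); first by [].
  rewrite RmE C0E.
  have -> : g (E i) adj = g (nabla (E i) xi) W.
    by rewrite gC (connection_xi_adj contact lcD) gC.
  rewrite (contact_phi_skew contact X) (gC xi).
  rewrite (contact_phi_skew contact (E i) W).
  pose e := g (E i) (E i).
  (* Operations on smooth functions are pointwise, so evaluation at [q] holds by conversion and
     [ring] can regroup real numbers. *)
  transitivity
    (c q * ((e q - g (E i) xi q * g (E i) xi q) * (g X W q - g X xi q * g W xi q)
       - (g X (E i) q - g X xi q * g (E i) xi q) *
         (g (E i) W q - g (E i) xi q * g W xi q))
     - g (nabla (E i) xi) (E i) q * g (nabla X xi) W q
     + g (nabla X xi) (E i) q * g (nabla (E i) xi) W q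
     - (g X (phi (E i)) q + g X (phi (E i)) q) * (- g (E i) (phi W) q)
     + k q * ((g X W q - g X xi q * g W xi q) * (g (E i) xi q * g (E i) xi q)
       + (e q - g (E i) xi q * g (E i) xi q) * (g X xi q * g W xi q)
       - (g X (E i) q - g X xi q * g (E i) xi q) * (g (E i) xi q * g W xi q)
       - (g (E i) W q - g (E i) xi q * g W xi q) * (g X xi q * g (E i) xi q))).
    by [].
  rewrite /e gEE; change ((- g X (phi (E i))) q) with (- g X (phi (E i)) q).
  ring.
under eq_bigr do rewrite term.
rewrite !(big_split, sumrN) /= sumr_const card_ord -!mulr_sumr !gsum trace0 AA phi_phi_q.
rewrite (contact_metric_xi contact) (gC xi).
have natE j : (j%:R : Cinf M) q = j%:R := rmorph_nat (eval q) j.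
pose N : Cinf M := (2 * n)%:R.
transitivity ((N q * c q - c q - 1 - 1) * g X W q +
  (N q * k q - (N q * c q - c q - 1 - 1)) * g X xi q * g W xi q); last by [].
rewrite natE mulrS -(mulr_natr C0); change ((1 : Cinf M) q) with (1 : R).
rewrite C0E; move: (2 * n)%:R => N'; ring.
Qed.
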